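(* Let $d\ge2$, let $\rho=\rho^{Q_1\cdots Q_n}$ be a state on $n$ qudits of dimension $d$, and let $k\le n$. Let $\Lambda$ be a measurement on $\mathbb{C}^d$ with at most $d^8$ outcomes such that $\|\xi\|_1\le(18d)^{k'/2}\|\Lambda^{\otimes k'}(\xi)\|_1$ for every positive integer $k'$ and every traceless Hermitian $\xi$ on $(\mathbb{C}^d)^{\otimes k'}$. For every integer $t\le n-k$ there is an integer $m\le t$ such that the following holds. Let $\vec i=(i_1,\ldots,i_k)$ and $\vec j=(j_1,\ldots,j_m)$ be random disjoint ordered subsets of $[n]$, and let $\vec x=(x_1,\ldots,x_m)$ be the measurement outcomes resulting from applying $\Lambda^{\otimes m}$ to $Q_{j_1}\cdots Q_{j_m}$ of $\rho$. Let $\rho_{\vec j,\vec x}$ be the post-measurement state conditioned on obtaining outcomes $\vec x$. Then $$\mathbb{E}_{\vec j,\vec x}\,\mathbb{E}_{\vec i}\left\|\rho^{Q_{i_1}\cdots Q_{i_k}}_{\vec j,\vec x}-\rho^{Q_{i_1}}_{\vec j,\vec x}\otimes\cdots\otimes\rho^{Q_{i_k}}_{\vec j,\vec x}\right\|_1^2\le\frac{4\ln(d)(18d)^kk^2}{t}.$$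
   Context: A measurement is the channel $\Lambda(\rho)=\sum_x\operatorname{tr}(M_x\rho)|x\rangle\langle x|$ for a POVM $\{M_x\}$ ($M_x\ge0$, $\sum_xM_x=I$). Random disjoint ordered subsets are uniformly random tuples of distinct indices sharing no index; $\vec x$ is distributed according to the outcome distribution of the measurement. Superscripts denote reduced states and $\|\cdot\|_1$ is the trace norm. *)

(* Defs.v *)
From mathcomp Require Import all_boot all_order all_algebra.
From mathcomp Require Import complex.
From mathcomp Require Import reals exp.

Set Implicit Arguments.
Unset Strict Implicit.
Unset Printing Implicit Defensive.

Import Order.TTheory GRing.Theory Num.Theory.
Local Open Scope ring_scope.
Local Open Scope complex_scope.

Section Quantum.
Variable R : realType.
Local Notation C := (complex R).

(* An operator on the Hilbert space with orthonormal basis indexed by the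
   finite type T, given by its matrix entries  A a b = <a|A|b>. *)
Definition op (T : finType) := T -> T -> C.

(* Computational basis of a register of qudits of dimension d labelled by L:
   one value in 'I_d for each qudit. *)
Definition cfg (L : finType) (d : nat) := {ffun L -> 'I_d}.

Definition trace_op (T : finType) (A : op T) : C := \sum_(a : T) A a a.

Definition herm_op (T : finType) (A : op T) : Prop :=
  forall a b, A b a = Num.conj (A a b).

Definition psd_op (T : finType) (A : op T) : Prop :=
  herm_op A /\
  forall v : T -> C, 0 <= \sum_(a : T) \sum_(b : T) Num.conj (v a) * A a b * v b.

Definition is_state (T : finType) (rho : op T) : Prop :=
  psd_op rho /\ trace_op rho = 1.

Definition mx_of_op (T : finType) (A : op T) : 'M[C]_#|T| :=
  \matrix_(i, j) A (enum_val i) (enum_val j).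

(* trace norm ||A||_1 = tr sqrt(A^* A) = sum of the square roots of the
   eigenvalues of the (Hermitian, hence normal) matrix A^* A. *)
Definition trnorm (T : finType) (A : op T) : R :=
  let M := mx_of_op A in
  complex.Re (\sum_i sqrtC (spectral_diag ((map_mx Num.conj M)^T *m M) 0 i)).

(* Reduced state of rho on the ordered list of qudits i_1 ... i_k
   (partial trace over all qudits not in the range of i). *)
Definition reduced (L : finType) (d k : nat) (rho : op (cfg L d))
  (i : {ffun 'I_k -> L}) : op (cfg 'I_k d) :=
  fun a b => \sum_(u : cfg L d) \sum_(v : cfg L d |
      [forall l, u (i l) == a l] && [forall l, v (i l) == b l] &&
      [forall p, (p \notin codom i) ==> (u p == v p)]) rho u v.

Definition marg1 (L : finType) (d : nat) (rho : op (cfg L d)) (p : L) :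
  op (cfg 'I_1 d) := reduced rho [ffun _ : 'I_1 => p].

Definition prod_marg (L : finType) (d k : nat) (rho : op (cfg L d))
  (i : {ffun 'I_k -> L}) : op (cfg 'I_k d) :=
  fun a b => \prod_(l < k)
    marg1 rho (i l) [ffun _ : 'I_1 => a l] [ffun _ : 'I_1 => b l].

Definition is_povm (X : finType) (d : nat) (M : X -> op 'I_d) : Prop :=
  (forall x, psd_op (M x)) /\
  (forall a b : 'I_d, \sum_(x : X) M x a b = (a == b)%:R).

(* Lambda^{(x) k}(xi) = sum_x tr((M_{x_1} (x) ... (x) M_{x_k}) xi) |x><x| *)
Definition meas_tensor (X : finType) (d k : nat) (M : X -> op 'I_d)
  (xi : op (cfg 'I_k d)) : op {ffun 'I_k -> X} :=
  fun x y => (x == y)%:R *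
    \sum_(a : cfg 'I_k d) \sum_(b : cfg 'I_k d)
       (\prod_(l < k) M (x l) (a l) (b l)) * xi b a.

(* probability of outcomes x when Lambda^{(x) m} is applied to
   Q_{j_1} ... Q_{j_m} of rho:  tr((M_{x_1} (x) ... (x) M_{x_m}) rho^{Q_j}) *)
Definition outcome_prob (X : finType) (d n m : nat) (M : X -> op 'I_d)
  (rho : op (cfg 'I_n d)) (j : {ffun 'I_m -> 'I_n}) (x : {ffun 'I_m -> X}) : R :=
  complex.Re (\sum_(a : cfg 'I_m d) \sum_(b : cfg 'I_m d)
     (\prod_(l < m) M (x l) (a l) (b l)) * reduced rho j b a).

Definition compl (n m : nat) (j : {ffun 'I_m -> 'I_n}) : finType :=
  {p : 'I_n | p \notin codom j}.

(* post-measurement state rho_{j,x} of the unmeasured qudits, conditioned on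
   outcomes x:  tr_{Q_j}((M_{x_1} (x) ... (x) M_{x_m} (x) I) rho) / p(x). *)
Definition post_state (X : finType) (d n m : nat) (M : X -> op 'I_d)
  (rho : op (cfg 'I_n d)) (j : {ffun 'I_m -> 'I_n}) (x : {ffun 'I_m -> X}) :
  op (cfg (compl j) d) :=
  fun a b =>
    (\sum_(u : cfg 'I_n d) \sum_(v : cfg 'I_n d |
        [forall p : compl j, u (val p) == a p] &&
        [forall p : compl j, v (val p) == b p])
       (\prod_(l < m) M (x l) (v (j l)) (u (j l))) * rho u v)
    / (outcome_prob M rho j x)%:C.

Definition avg (T : finType) (P : pred T) (F : T -> R) : R :=
  (\sum_(t | P t) F t) / #|[pred t | P t]|%:R.

End Quantum.

Arguments post_state {R X d n m} M rho j x _ _.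

(* Main.v *)
Require Import Defs.
From mathcomp Require Import all_boot all_order all_algebra.
From mathcomp Require Import complex.
From mathcomp Require Import reals exp.
From mathcomp Require Import perm fingroup sesquilinear spectral.
From mathcomp Require Import ring lra.
Import Order.TTheory GRing.Theory Num.Theory.
Local Open Scope ring_scope.
Set Implicit Arguments.
Unset Strict Implicit.
Unset Printing Implicit Defensive.

(** Let q be the outcome distribution of measuring all n qudits. By the distortion hypothesis and
    a Pinsker-type inequality, the expected squared distance is at most 4 (18 d)^k times the mean
    conditional information I(X_i1 : ... : X_ik | X_j) under q. Let G S be the relative entropy of
    the marginal of q on S with respect to the product of the weights r(c) = tr(M_c) / d, and W(s)
    its mean over random s-subsets. The mean information is
    W(m + k) - W(m) - k (W(m + 1) - W(m)), and the increments of W lie in [0, ln d]: the lower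
    bound is Gibbs' inequality, the upper one follows from M_c <= tr(M_c) I, so that conditional
    probabilities never exceed d r(c). Summed over m < t the expression telescopes to at most
    k^2 ln d, hence some m < t achieves k^2 ln d / t. Using r instead of the Shannon entropy makes
    the number of outcomes irrelevant. *)

(** * Hellinger distance and relative entropy *)

(** Lagrange's identity: twice the difference of the two sides is the double sum of the squares of
    [a i * b j - b i * a j]. The general [F] allows its use both for reals and for norms inside the
    complex numbers. *)
Lemma sum_mul_sqr_le (F : numDomainType) (I : finType) (a b : I -> F) :
  (forall i, a i \is Num.real) -> (forall i, b i \is Num.real) ->
  (\sum_i a i * b i) ^+ 2 <= (\sum_i a i ^+ 2) * (\sum_i b i ^+ 2).
Proof.
move=> ar br; rewrite -(@ler_pMn2r _ 2) // !mulr2n.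
rewrite expr2 [X in _ <= _ + X]mulrC !mulr_suml -!big_split /=; apply: ler_sum => i _.
rewrite !mulr_sumr -!big_split /=; apply: ler_sum => j _.
rewrite -subr_ge0.
have -> : a i ^+ 2 * b j ^+ 2 + b i ^+ 2 * a j ^+ 2 -
  (a i * b i * (a j * b j) + a i * b i * (a j * b j)) = (a i * b j - b i * a j) ^+ 2 by ring.
by rewrite real_exprn_even_ge0 // realB // realM.
Qed.

Lemma ln_le_sub1 (R : realType) (x : R) : 0 < x -> ln x <= x - 1.
Proof. by move=> x0; have := @le_ln1Dx R (x - 1); rewrite subrKC; apply; lra. Qed.

(** With [a] and [b] the square roots of [p] and [q], the right side is [- 2 * a ^+ 2 * ln (b / a)],
    and [ln (b / a) <= b / a - 1]. *)
Lemma hellinger_le_kl (R : realType) (p q : R) : 0 <= p -> 0 <= q -> (q = 0 -> p = 0) ->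
  2 * p - 2 * (Num.sqrt p * Num.sqrt q) <= p * (ln p - ln q).
Proof.
move=> p0 q0 pq; have [->|pn0] := eqVneq p 0; first by rewrite sqrtr0; lra.
have pp : 0 < p by rewrite lt_def pn0.
have qp : 0 < q by rewrite lt_def q0 andbT; apply: contra_neq pn0 => /pq.
set a := Num.sqrt p; set b := Num.sqrt q.
have a0 : 0 < a by rewrite sqrtr_gt0.
have b0 : 0 < b by rewrite sqrtr_gt0.
have -> : p = a ^+ 2 by rewrite sqr_sqrtr.
have -> : q = b ^+ 2 by rewrite sqr_sqrtr.
have h : ln (b / a) <= b / a - 1 by apply: ln_le_sub1; rewrite divr_gt0.
rewrite ln_div ?posrE // in h.
rewrite !lnXn // !mulr2n.
have : a ^+ 2 * (ln b - ln a) <= a ^+ 2 * (b / a - 1) by rewrite ler_wpM2l // sqr_ge0.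
have -> : a ^+ 2 * (b / a - 1) = a * b - a ^+ 2 by field; rewrite gt_eqF.
by lra.
Qed.

(* Passing through the Hellinger distance gives the constant 4 instead of the optimal 2 of
   Pinsker's inequality; the theorem has room for this loss. *)
Lemma weak_pinsker (R : realType) (Y : finType) (p q : Y -> R) :
  (forall y, 0 <= p y) -> (forall y, 0 <= q y) ->
  \sum_y p y = 1 -> \sum_y q y = 1 -> (forall y, q y = 0 -> p y = 0) ->
  (\sum_y `|p y - q y|) ^+ 2 <= 4 * \sum_y p y * (ln (p y) - ln (q y)).
Proof.
move=> p0 q0 sp sq pq.
pose a y := Num.sqrt (p y); pose b y := Num.sqrt (q y).
have ap y : p y = a y ^+ 2 by rewrite sqr_sqrtr.
have bq y : q y = b y ^+ 2 by rewrite sqr_sqrtr.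
have a0 y : 0 <= a y by rewrite sqrtr_ge0.
have b0 y : 0 <= b y by rewrite sqrtr_ge0.
have -> : \sum_y `|p y - q y| = \sum_y `|a y - b y| * (a y + b y).
  apply: eq_bigr => y _; rewrite ap bq subr_sqr normrM [`|a y + b y|]ger0_norm //.
  exact: addr_ge0.
apply: le_trans (sum_mul_sqr_le _ _) _; try by move=> y; rewrite ?num_real.
(* After Cauchy-Schwarz, the first factor is the squared Hellinger distance. Since both
   distributions have mass 1, [p + q] may be replaced by [2 * p], the form that [hellinger_le_kl]
   bounds term by term. The second factor is at most 4 because
   [(a + b) ^+ 2 <= 2 * (a ^+ 2 + b ^+ 2)]. *)
have -> : \sum_y `|a y - b y| ^+ 2 = \sum_y (2 * p y - 2 * (a y * b y)).
  have -> : \sum_y `|a y - b y| ^+ 2 = \sum_y (p y + q y - 2 * (a y * b y)).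
    by apply: eq_bigr => y _; rewrite real_normK ?num_real // ap bq; ring.
  rewrite !sumrB big_split /= sp sq -[in RHS]mulr_sumr sp; ring.
rewrite mulrC; apply: ler_pM.
- by apply: sumr_ge0 => y _; rewrite sqr_ge0.
- have -> : \sum_y (2 * p y - 2 * (a y * b y)) = \sum_y (p y + q y - 2 * (a y * b y)).
    rewrite !sumrB big_split /= sp sq -[in LHS]mulr_sumr sp; ring.
  by apply: sumr_ge0 => y _; rewrite ap bq; have := sqr_ge0 (a y - b y); lra.
- have -> : 4 = \sum_y 2 * (p y + q y) by rewrite -mulr_sumr big_split /= sp sq; ring.
  by apply: ler_sum => y _; rewrite ap bq; have := sqr_ge0 (a y - b y); lra.
- by apply: ler_sum => y _; apply: hellinger_le_kl; auto.
Qed.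

(** * Relative entropy of marginals with respect to a product distribution *)

Section RelativeEntropy.
Variables (R : realType) (L X : finType) (q : {ffun L -> X} -> R) (r : X -> R) (K : R).
Implicit Types (S : {set L}) (y z : {ffun L -> X}).

Definition agree S y z := [forall p in S, y p == z p].
Definition marg S y : R := \sum_(z | agree S z y) q z.
(* Relative entropy of the marginal of q on S with respect to the product of copies of r.
   Whenever ln is taken at 0 its factor q y vanishes. *)
Definition relent S : R := \sum_y q y * (ln (marg S y) - \sum_(p in S) ln (r (y p))).

Hypothesis q_ge0 : forall y, 0 <= q y.
Hypothesis q_sum1 : \sum_y q y = 1.
Hypothesis r_ge0 : forall x, 0 <= r x.
Hypothesis r_sum1 : \sum_x r x = 1.
Hypothesis K_gt0 : 0 < K.
Hypothesis marg_dom : forall S p y, p \notin S -> marg (p |: S) y <= K * r (y p) * marg S y.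

Lemma agreeU1 S p y z : agree (p |: S) y z = (y p == z p) && agree S y z.
Proof.
apply/forall_inP/andP => [h|[/eqP h /forall_inP h'] o].
  by split; [apply: h; rewrite setU11|apply/forall_inP => o oS; apply: h; rewrite setU1r].
by case/setU1P => [->|/h']; rewrite ?h.
Qed.

Lemma agree_refl S y : agree S y y.
Proof. exact/forall_inP. Qed.

Lemma agree_sym S y z : agree S y z = agree S z y.
Proof. by apply: eq_forallb_in => p _; rewrite eq_sym. Qed.

Lemma agree_trans S w y z : agree S y z -> agree S w y = agree S w z.
Proof. by move=> /forall_inP h; apply: eq_forallb_in => p /h /eqP ->. Qed.

Lemma le_marg S y : q y <= marg S y.
Proof. by rewrite /marg (bigD1 y) ?agree_refl //= lerDl sumr_ge0. Qed.

Lemma marg_gt0 S y : 0 < q y -> 0 < marg S y.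
Proof. by move=> h; apply: lt_le_trans (le_marg S y). Qed.

(** A zero weight would, by [marg_dom], force a zero marginal at [p], which is at least [q y]. *)
Lemma outcome_weight_gt0 y p : 0 < q y -> 0 < r (y p).
Proof.
move=> qy; rewrite lt_def r_ge0 andbT; apply: contraTneq (marg_gt0 (p |: set0) qy) => r0.
by rewrite -leNgt; apply: le_trans (marg_dom _ _) _; rewrite ?inE // r0 mulr0 mul0r.
Qed.

Lemma ler_sum_weight (f g : {ffun L -> X} -> R) :
  (forall y, 0 < q y -> f y <= g y) -> \sum_y q y * f y <= \sum_y q y * g y.
Proof.
move=> fg; apply: ler_sum => y _; have [->|qn0] := eqVneq (q y) 0; first by rewrite !mul0r.
by apply: ler_wpM2l => //; apply: fg; rewrite lt_def qn0 q_ge0.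
Qed.

Lemma relentU1 S p : p \notin S -> relent (p |: S) - relent S =
  \sum_y q y * (ln (marg (p |: S) y) - ln (marg S y) - ln (r (y p))).
Proof.
move=> pS; rewrite -sumrB; apply: eq_bigr => y _; rewrite -mulrBr big_setU1 //=; congr (_ * _).
by ring.
Qed.

Lemma relentU1_le S p : p \notin S -> relent (p |: S) - relent S <= ln K.
Proof.
move=> pS; rewrite relentU1 // -[ln K]mul1r -q_sum1 mulr_suml; apply: ler_sum_weight => y qy.
have m0 := marg_gt0 S qy; have m1 := marg_gt0 (p |: S) qy; have rp := outcome_weight_gt0 p qy.
have := marg_dom y pS; rewrite -ler_ln ?posrE ?mulr_gt0 // !lnM ?posrE ?mulr_gt0 //; lra.
Qed.

(** Gibbs' inequality for the conditional law of coordinate [p] given [S] against [r]: since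
    [ln u >= 1 - 1 / u], it suffices that the mean of [marg S y * r (y p) / marg (p |: S) y] is at
    most 1. *)
Lemma relentU1_ge0 S p : p \notin S -> 0 <= relent (p |: S) - relent S.
Proof.
move=> pS; rewrite relentU1 //.
have h : \sum_y q y * (1 - marg S y * r (y p) / marg (p |: S) y) <=
    \sum_y q y * (ln (marg (p |: S) y) - ln (marg S y) - ln (r (y p))).
  apply: ler_sum_weight => y qy.
  have m0 := marg_gt0 S qy; have m1 := marg_gt0 (p |: S) qy; have rp := outcome_weight_gt0 p qy.
  have := @ln_le_sub1 R (marg S y * r (y p) / marg (p |: S) y).
  by rewrite divr_gt0 ?mulr_gt0 // ln_div ?posrE ?mulr_gt0 // lnM ?posrE // => /(_ isT); lra.
apply: le_trans h; under eq_bigr do rewrite mulrBr mulr1.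
rewrite sumrB q_sum1 subr_ge0.
(* Expanding [marg S y] and exchanging the sums leaves, for each [z], a sum over the [S]-class of
   [z], which is then split by the value of coordinate [p]. *)
have -> : \sum_y q y * (marg S y * r (y p) / marg (p |: S) y) =
    \sum_z q z * \sum_(y | agree S y z) q y * r (y p) / marg (p |: S) y.
  under [RHS]eq_bigr do rewrite mulr_sumr.
  rewrite (exchange_big_dep xpredT) //=; apply: eq_bigr => y _.
  rewrite /(marg S y) !mulr_suml mulr_sumr; apply: eq_big => [z|z _]; first exact: agree_sym.
  by ring.
rewrite -q_sum1; apply: ler_sum => z _; rewrite -[leRHS]mulr1; apply: ler_wpM2l => //.
rewrite (partition_big (fun y : {ffun L -> X} => y p) xpredT) //= -r_sum1.
apply: ler_sum => x _.
(* On this group [marg (p |: S)] is constant with value [A], so the group contributes [r x], or 0 if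
   [A] vanishes. *)
pose A := \sum_(y | agree S y z && (y p == x)) q y.
have -> : \sum_(y | agree S y z && (y p == x)) q y * r (y p) / marg (p |: S) y = A * (r x / A).
  rewrite mulr_suml; apply: eq_bigr => y /andP[yz /eqP yx].
  rewrite yx -mulrA; congr (_ * (_ / _)); apply: eq_bigl => w.
  by rewrite agreeU1 yx andbC (agree_trans _ yz).
have [->|An0] := eqVneq A 0; first by rewrite mul0r.
by rewrite mulrCA divff // mulr1.
Qed.

(** * Conditional multipartite information and its Pinsker inequality *)

Section Conditional.
Variables (m k : nat) (j : {ffun 'I_m -> L}) (i : {ffun 'I_k -> L}).
Hypothesis i_inj : injective i.
Hypothesis ij : forall l, i l \notin [set j o | o in 'I_m].

Definition pull (h : nat) (f : {ffun 'I_h -> L}) y : {ffun 'I_h -> X} := [ffun l => y (f l)].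

Definition pr_j (x : {ffun 'I_m -> X}) : R := \sum_(y | pull j y == x) q y.
Definition pr_ji (x : {ffun 'I_m -> X}) (x' : {ffun 'I_k -> X}) : R :=
  \sum_(y | (pull j y == x) && (pull i y == x')) q y.
Definition pr_j1 (x : {ffun 'I_m -> X}) (l : 'I_k) (c : X) : R :=
  \sum_(y | (pull j y == x) && (y (i l) == c)) q y.

Lemma agree_im (h : nat) (f : {ffun 'I_h -> L}) y z :
  agree [set f l | l in 'I_h] y z = (pull f y == pull f z).
Proof.
apply/forall_inP/eqP => [H|/ffunP H p /imsetP[l _ ->]].
  by apply/ffunP => l; rewrite !ffunE; apply/eqP/H/imset_f.
by have := H l; rewrite !ffunE => ->.
Qed.

Lemma agreeU S S' y z : agree (S :|: S') y z = agree S y z && agree S' y z.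
Proof.
apply/forall_inP/andP => [H|[/forall_inP H /forall_inP H'] p /setUP[/H|/H'] //].
by split; apply/forall_inP => p pS; apply: H; rewrite inE pS ?orbT.
Qed.

Lemma marg_j y : marg [set j o | o in 'I_m] y = pr_j (pull j y).
Proof. by apply: eq_bigl => z; rewrite agree_im. Qed.

Lemma marg_ji y : marg ([set j o | o in 'I_m] :|: [set i l | l in 'I_k]) y =
  pr_ji (pull j y) (pull i y).
Proof. by apply: eq_bigl => z; rewrite agreeU !agree_im. Qed.

Lemma marg_j1 y l : marg (i l |: [set j o | o in 'I_m]) y = pr_j1 (pull j y) l (y (i l)).
Proof. by apply: eq_bigl => z; rewrite agreeU1 agree_im andbC. Qed.

(* Conditional multipartite information I(i_1 : ... : i_k | j): the r-terms cancel. *)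
Definition multi_info : R :=
  relent ([set j o | o in 'I_m] :|: [set i l | l in 'I_k]) - relent [set j o | o in 'I_m]
  - \sum_l (relent (i l |: [set j o | o in 'I_m]) - relent [set j o | o in 'I_m]).

Lemma multi_infoE : multi_info = \sum_x \sum_x' pr_ji x x' *
  (ln (pr_ji x x') - ln (pr_j x) - \sum_l (ln (pr_j1 x l (x' l)) - ln (pr_j x))).
Proof.
have -> : multi_info = \sum_y q y * (ln (pr_ji (pull j y) (pull i y)) - ln (pr_j (pull j y))
    - \sum_l (ln (pr_j1 (pull j y) l (pull i y l)) - ln (pr_j (pull j y)))).
  rewrite /multi_info.
  under [X in _ - X]eq_bigr do rewrite relentU1 //.
  rewrite -sumrB exchange_big -sumrB; apply: eq_bigr => y _ /=.
  rewrite -mulr_sumr -!mulrBr; congr (_ * _).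
  (* Disjointness ([ij]) splits the sum of [ln (r (y p))] over the union, and injectivity of [i]
     reindexes its second half by [l]; it then cancels against the one-coordinate terms. *)
  rewrite marg_ji marg_j (eq_bigl _ _ (fun p => in_setU p _ _)) bigU /=; last first.
    rewrite -setI_eq0; apply/eqP/setP => p; rewrite !inE; apply/negP => /andP[pj /imsetP[l _ pl]].
    by have := ij l; rewrite -pl pj.
  rewrite [\sum_(p in [set i l | l in 'I_k]) _]big_imset /=; last by move=> ? ? _ _; apply: i_inj.
  have -> : \sum_l (ln (marg (i l |: [set j o | o in 'I_m]) y) - ln (pr_j (pull j y))
       - ln (r (y (i l)))) =
      \sum_l (ln (pr_j1 (pull j y) l (pull i y l)) - ln (pr_j (pull j y)))
      - \sum_l ln (r (y (i l))).
    by rewrite -sumrB; apply: eq_bigr => l _; rewrite marg_j1 ffunE.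
  by ring.
rewrite (partition_big (pull j) xpredT) //=; apply: eq_bigr => x _.
rewrite (partition_big (pull i) xpredT) //=; apply: eq_bigr => x' _.
by rewrite mulr_suml; apply: eq_bigr => y /andP[/eqP -> /eqP ->].
Qed.

Lemma pr_j_ge0 x : 0 <= pr_j x. Proof. exact: sumr_ge0. Qed.
Lemma pr_ji_ge0 x x' : 0 <= pr_ji x x'. Proof. exact: sumr_ge0. Qed.
Lemma pr_j1_ge0 x l c : 0 <= pr_j1 x l c. Proof. exact: sumr_ge0. Qed.

Lemma sum_pr_ji x : \sum_x' pr_ji x x' = pr_j x.
Proof. by rewrite /pr_j (partition_big (pull i) xpredT). Qed.

Lemma sum_pr_j1 x l : \sum_c pr_j1 x l c = pr_j x.
Proof. by rewrite /pr_j (partition_big (fun y : {ffun L -> X} => y (i l)) xpredT). Qed.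

Lemma pr_ji_le x x' l : pr_ji x x' <= pr_j1 x l (x' l).
Proof.
rewrite /pr_ji /pr_j1 [leRHS](bigID (fun y => pull i y == x')) /=.
rewrite [X in _ <= X + _](_ : _ = pr_ji x x') ?lerDl ?sumr_ge0 //.
apply: eq_bigl => y; rewrite -andbA; congr (_ && _).
by case: (pull i y =P x') => [<-|]; rewrite ?andbF // ffunE eqxx.
Qed.

(** For each [x] of positive probability, [weak_pinsker] compares the conditional joint law [f] with
    the product [g] of the conditional one-coordinate laws. By [multi_infoE], the average of the
    relative entropies is [multi_info]. *)
Lemma conditional_pinsker : \sum_x pr_j x *
    (\sum_x' `|pr_ji x x' / pr_j x - \prod_l (pr_j1 x l (x' l) / pr_j x)|) ^+ 2
  <= 4 * multi_info.
Proof.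
rewrite multi_infoE mulr_sumr; apply: ler_sum => x _.
have [p0|pn0] := eqVneq (pr_j x) 0.
  rewrite p0 mul0r big1 ?mulr0 // => x' _; suff -> : pr_ji x x' = 0 by rewrite mul0r.
  have := sum_pr_ji x; rewrite p0 => /psumr_eq0P; apply=> // z _; exact: pr_ji_ge0.
have pp : 0 < pr_j x by rewrite lt_def pn0 pr_j_ge0.
set f := fun x' => pr_ji x x' / pr_j x.
set g := fun x' : {ffun 'I_k -> X} => \prod_l (pr_j1 x l (x' l) / pr_j x).
have f0 x' : 0 <= f x' by rewrite divr_ge0 ?pr_ji_ge0 ?pr_j_ge0.
have fac0 l c : 0 <= pr_j1 x l c / pr_j x by rewrite divr_ge0 ?pr_j1_ge0 ?pr_j_ge0.
(* Absolute continuity: a vanishing factor of [g] bounds the joint probability by 0 through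
   [pr_ji_le]. *)
have fg : forall x', g x' = 0 -> f x' = 0.
  move=> x' /eqP /prodf_eq0 [l _]; rewrite mulf_eq0 invr_eq0 (negPf pn0) orbF => /eqP e.
  apply/eqP; rewrite mulf_eq0 -[pr_ji _ _ == 0]andbT eq_le pr_ji_ge0 !andbT.
  by rewrite -{1}e pr_ji_le.
have H := @weak_pinsker R _ f g f0 _ _ _ fg.
apply: le_trans (ler_wpM2l (ltW pp) (H _ _ _)) _.
- by move=> x'; apply: prodr_ge0.
- by rewrite -mulr_suml sum_pr_ji divff.
- rewrite -(bigA_distr_bigA (fun l c => pr_j1 x l c / pr_j x)) /= big1 // => l _.
  by rewrite -mulr_suml sum_pr_j1 divff.
rewrite mulrCA; apply: ler_wpM2l => //; rewrite mulr_sumr; apply: ler_sum => x' _.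
rewrite mulrA [pr_j x * f x']mulrC divfK //.
have [->|jin0] := eqVneq (pr_ji x x') 0; first by rewrite !mul0r.
have jip : 0 < pr_ji x x' by rewrite lt_def jin0 pr_ji_ge0.
have j1p l : 0 < pr_j1 x l (x' l) by apply: lt_le_trans jip (pr_ji_le _ _ _).
rewrite /f ln_div ?posrE // /g.
suff -> : ln (\prod_l (pr_j1 x l (x' l) / pr_j x)) =
  \sum_l (ln (pr_j1 x l (x' l)) - ln (pr_j x)) by [].
rewrite -[RHS]expRK; congr ln; rewrite expR_sum; apply: eq_bigr => l _.
by rewrite -ln_div ?posrE // lnK // posrE divr_gt0.
Qed.

End Conditional.
End RelativeEntropy.

(** * Averages over random disjoint tuples *)

Section RandomTuples.
Variables (R : realType) (n : nat).

Definition tuple_set (h : nat) (f : {ffun 'I_h -> 'I_n}) : {set 'I_n} := [set f l | l in 'I_h].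

Definition ffval (m k : nat) (j : {ffun 'I_m -> 'I_n}) (i : {ffun 'I_k -> compl j}) :
  {ffun 'I_k -> 'I_n} := [ffun l => val (i l)].

(** Describes the image under [ffval] of the injective tuples, so that sums over [i] range over a
    type independent of [j]. *)
Definition fresh (m k : nat) (j : {ffun 'I_m -> 'I_n}) (i : {ffun 'I_k -> 'I_n}) :=
  injectiveb i && [forall l, i l \notin codom j].

Lemma ler_avg (T : finType) (P : pred T) (F F' : T -> R) :
  (forall t, P t -> F t <= F' t) -> avg P F <= avg P F'.
Proof. by move=> FF; rewrite /avg ler_wpM2r ?invr_ge0 ?ler0n // ler_sum. Qed.

Lemma avgMl (T : finType) (P : pred T) (c : R) (F : T -> R) :
  avg P (fun t => c * F t) = c * avg P F.
Proof. by rewrite /avg -mulr_sumr mulrA. Qed.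

Lemma sum_mul_avg (I T : finType) (P : pred T) (c : I -> R) (F : I -> T -> R) :
  \sum_i c i * avg P (F i) = avg P (fun t => \sum_i c i * F i t).
Proof.
rewrite /avg exchange_big mulr_suml; apply: eq_bigr => i _.
by rewrite mulrA -mulr_sumr.
Qed.

Lemma sum_ffval (m k : nat) (j : {ffun 'I_m -> 'I_n}) (F : {ffun 'I_k -> 'I_n} -> R) :
  \sum_(i : {ffun 'I_k -> compl j} | injectiveb i) F (ffval i) = \sum_(i | fresh j i) F i.
Proof.
have vinj : injective (@ffval m k j).
  move=> i i' /ffunP e; apply/ffunP => l; apply: val_inj; have := e l; by rewrite !ffunE.
rewrite -(big_imset F (A := [pred i : {ffun 'I_k -> compl j} | injectiveb i])) /=;
  last by move=> i i' _ _; apply: vinj.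
apply: eq_bigl => i; apply/imsetP/andP => [[i0 /injectiveP ii ->]|[/injectiveP ii /forallP nj]].
  split; last by apply/forallP => l; rewrite ffunE (valP (i0 l)).
  by apply/injectiveP => l l'; rewrite !ffunE => /val_inj /ii.
have e : i = ffval [ffun l => exist (fun p => p \notin codom j) (i l) (nj l) : compl j].
  by apply/ffunP => l; rewrite !ffunE.
exists [ffun l => exist (fun p => p \notin codom j) (i l) (nj l) : compl j] => //.
by apply/injectiveP => l l'; rewrite !ffunE => -[/ii].
Qed.

Lemma card_injective (T : finType) (h : nat) :
  #|[pred f : {ffun 'I_h -> T} | injectiveb f]| = #|T| ^_ h.
Proof.
rewrite -[h in RHS]card_ord -card_inj_ffuns; apply: eq_card => f.
by rewrite !inE.
Qed.

Lemma card_tuple_set (h : nat) (f : {ffun 'I_h -> 'I_n}) : injective f -> #|tuple_set f| = h.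
Proof. by move=> fi; rewrite card_imset // card_ord. Qed.

Lemma card_compl (m : nat) (j : {ffun 'I_m -> 'I_n}) : injective j -> #|compl j| = (n - m)%N.
Proof.
move=> ji; rewrite card_sig.
have cj : #|codom j| = m by rewrite card_codom // card_ord.
have := cardC (mem (codom j)); rewrite cj card_ord => e.
by rewrite -[X in (X - _)%N]e addKn; apply: eq_card => p; rewrite !inE.
Qed.

Definition tuple_mean (m k : nat) (F : {ffun 'I_m -> 'I_n} -> {ffun 'I_k -> 'I_n} -> R) : R :=
  (\sum_(j : {ffun 'I_m -> 'I_n} | injectiveb j) \sum_(i | fresh j i) F j i)
    / (n ^_ m * (n - m) ^_ k)%:R.

(** The number of inner tuples depends only on [m] and [k], not on [j], so the nested average is one
    uniform average. *)
Lemma avg_tuple_mean (m k : nat) (F : {ffun 'I_m -> 'I_n} -> {ffun 'I_k -> 'I_n} -> R) :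
  avg (fun j : {ffun 'I_m -> 'I_n} => injectiveb j)
    (fun j => avg (fun i : {ffun 'I_k -> compl j} => injectiveb i) (fun i => F j (ffval i)))
  = tuple_mean F.
Proof.
rewrite /avg /tuple_mean card_injective card_ord natrM invfM mulrA [RHS]mulrAC.
congr (_ / _); rewrite mulr_suml; apply: eq_bigr => j /injectiveP ji.
by rewrite card_injective card_compl // (sum_ffval j (F j)).
Qed.

Lemma tuple_meanB m k (F F' : {ffun 'I_m -> 'I_n} -> {ffun 'I_k -> 'I_n} -> R) :
  tuple_mean (fun j i => F j i - F' j i) = tuple_mean F - tuple_mean F'.
Proof.
rewrite /tuple_mean -mulrBl -sumrB; congr (_ / _).
by apply: eq_bigr => j _; rewrite sumrB.
Qed.

Lemma tuple_mean_sum m k (I : finType)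
  (F : I -> {ffun 'I_m -> 'I_n} -> {ffun 'I_k -> 'I_n} -> R) :
  tuple_mean (fun j i => \sum_o F o j i) = \sum_o tuple_mean (F o).
Proof.
rewrite /tuple_mean -mulr_suml; congr (_ / _); rewrite exchange_big.
by apply: eq_bigr => j _; rewrite exchange_big.
Qed.

Lemma tuple_mean_cst m k (c : R) : (m + k <= n)%N ->
  @tuple_mean m k (fun _ _ => c) = c.
Proof.
move=> mkn; rewrite -avg_tuple_mean /avg card_injective card_ord.
rewrite (eq_bigr (fun _ => c)); last first.
  move=> j /injectiveP ji; rewrite sumr_const card_injective card_compl //.
  by rewrite -[c *+ _]mulr_natr mulfK // pnatr_eq0 -lt0n ffact_gt0 leq_subRL //
    (leq_trans _ mkn) ?leq_addr.
rewrite sumr_const card_injective card_ord.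
by rewrite -[c *+ _]mulr_natr mulfK // pnatr_eq0 -lt0n ffact_gt0 (leq_trans _ mkn) ?leq_addr.
Qed.

(** * Action of permutations of the qudits on tuples *)

Definition act (h : nat) (s : 'S_n) (f : {ffun 'I_h -> 'I_n}) : {ffun 'I_h -> 'I_n} :=
  [ffun l => s (f l)].

Lemma act_inj h s : injective (@act h s).
Proof. by move=> f g /ffunP e; apply/ffunP => l; have := e l; rewrite !ffunE => /perm_inj. Qed.

Lemma injectiveb_act h s (f : {ffun 'I_h -> 'I_n}) : injectiveb (act s f) = injectiveb f.
Proof.
apply/injectiveP/injectiveP => fi l l' e; apply: fi; first by rewrite !ffunE e.
by move: e; rewrite !ffunE => /perm_inj.
Qed.

Lemma fresh_act m k s (j : {ffun 'I_m -> 'I_n}) (i : {ffun 'I_k -> 'I_n}) :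
  fresh (act s j) (act s i) = fresh j i.
Proof.
rewrite /fresh injectiveb_act; congr (_ && _); apply: eq_forallb => l; congr (~~ _).
apply/codomP/codomP => -[o]; first by rewrite !ffunE => /perm_inj ->; exists o.
by move=> e; exists o; rewrite !ffunE e.
Qed.

Lemma tuple_mean_act m k s (F : {ffun 'I_m -> 'I_n} -> {ffun 'I_k -> 'I_n} -> R) :
  tuple_mean (fun j i => F (act s j) (act s i)) = tuple_mean F.
Proof.
rewrite /tuple_mean; congr (_ / _); rewrite [RHS](reindex_inj (@act_inj m s)).
apply: eq_big => [j|j _]; first by rewrite injectiveb_act.
rewrite [RHS](reindex_inj (@act_inj k s)).
by apply: eq_bigl => i; rewrite fresh_act.
Qed.

Lemma tuple_set_act h s (f : {ffun 'I_h -> 'I_n}) : tuple_set (act s f) = s @: tuple_set f.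
Proof. by rewrite /tuple_set -imset_comp; apply: eq_imset => l; rewrite ffunE. Qed.

(** * Means of a set function over random subsets *)

Variable G : {set 'I_n} -> R.

Definition initial (s : nat) : {set 'I_n} := [set p : 'I_n | (p < s)%N].

(** A random [s]-subset is the image of the first [s] indices under a random permutation; the same
    permutation thus couples subsets of successive sizes. *)
Definition set_mean (s : nat) : R := (\sum_(g : 'S_n) G (g @: initial s)) / (n`!)%:R.

Lemma card_initial s : (s <= n)%N -> #|initial s| = s.
Proof.
move=> sn; have wi : injective (widen_ord sn) by move=> a b /(congr1 val) /= e; apply: val_inj.
rewrite -[RHS]card_ord -(card_imset _ wi).
apply: eq_card => p; rewrite inE; apply/idP/imsetP => [ps|[o _ ->] //=].
by exists (Ordinal ps) => //; apply: val_inj.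
Qed.

(** The permutation lists the elements of [S] first and those of its complement afterwards. *)
Lemma initial_transitive (S : {set 'I_n}) : exists g : 'S_n, S = g @: initial #|S|.
Proof.
pose e := enum S ++ enum (~: S).
have ue : uniq e.
  rewrite cat_uniq !enum_uniq andbT /=; apply/hasPn => p.
  by rewrite !mem_enum inE.
have se : size e = n by rewrite size_cat -!cardE cardsC card_ord.
have gi : injective (fun p : 'I_n => nth p e p).
  move=> p p' /eqP; rewrite (set_nth_default p) ?se // nth_uniq ?se // => /eqP.
  exact: val_inj.
exists (perm gi); apply/esym/eqP; rewrite eqEcard card_imset; last exact: perm_inj.
rewrite card_initial ?leqnn ?andbT; last by rewrite -[leqRHS]card_ord max_card.
apply/subsetP => p /imsetP[o]; rewrite inE => oS ->.
by rewrite permE nth_cat -cardE oS -mem_enum mem_nth // -cardE.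
Qed.

Lemma sum_perm_set (S : {set 'I_n}) : \sum_(g : 'S_n) G (g @: S) = set_mean #|S| * (n`!)%:R.
Proof.
rewrite /set_mean divfK ?pnatr_eq0 -?lt0n ?fact_gt0 //.
have [g {1}->] := initial_transitive S.
rewrite [RHS](reindex_inj (mulgI g)); apply: eq_bigr => h _; congr G.
by rewrite -imset_comp; apply: eq_imset => p; rewrite /= permM.
Qed.

(** The mean over tuples is unchanged by a permutation of the qudits. Averaging it over all
    permutations turns the term of each single pair [j], [i] into [set_mean s]. *)
Lemma tuple_mean_set (m k s : nat) (U : {ffun 'I_m -> 'I_n} -> {ffun 'I_k -> 'I_n} -> {set 'I_n}) :
  (m + k <= n)%N ->
  (forall g j i, U (act g j) (act g i) = g @: U j i) ->
  (forall (j : {ffun 'I_m -> 'I_n}) (i : {ffun 'I_k -> 'I_n}),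
    injectiveb j -> fresh j i -> #|U j i| = s) ->
  tuple_mean (fun j i => G (U j i)) = set_mean s.
Proof.
move=> mkn Ug Us.
have f0 : (n`!)%:R != 0 :> R by rewrite pnatr_eq0 -lt0n fact_gt0.
apply: (mulIf f0).
have -> : tuple_mean (fun j i => G (U j i)) * (n`!)%:R =
    \sum_(g : 'S_n) tuple_mean (fun j i => G (g @: U j i)).
  rewrite (eq_bigr (fun _ => tuple_mean (fun j i => G (U j i)))).
    by rewrite sumr_const card_Sn mulr_natr.
  move=> g _; rewrite -(tuple_mean_act g (fun j i => G (U j i))) /tuple_mean; congr (_ / _).
  by apply: eq_bigr => j _; apply: eq_bigr => i _; rewrite Ug.
rewrite -tuple_mean_sum -[RHS](@tuple_mean_cst m k) // /tuple_mean; congr (_ / _).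
by apply: eq_bigr => j ji; apply: eq_bigr => i fi; rewrite sum_perm_set Us.
Qed.

Variable B : R.
Hypothesis G_step : forall (S : {set 'I_n}) p, p \notin S -> 0 <= G (p |: S) - G S <= B.

Lemma set_mean_step s : (s < n)%N -> 0 <= set_mean s.+1 - set_mean s <= B.
Proof.
move=> sn; pose o := Ordinal sn.
have f0 : 0 < (n`!)%:R :> R by rewrite ltr0n fact_gt0.
have -> : set_mean s.+1 - set_mean s =
    (\sum_(g : 'S_n) (G (g o |: g @: initial s) - G (g @: initial s))) / (n`!)%:R.
  rewrite /set_mean -mulrBl -sumrB; congr (_ / _); apply: eq_bigr => g _.
  rewrite -imsetU1; suff -> : initial s.+1 = o |: initial s by [].
  by apply/setP => p; rewrite !inE ltnS leq_eqVlt.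
have st (g : 'S_n) : 0 <= G (g o |: g @: initial s) - G (g @: initial s) <= B.
  apply: G_step; apply/imsetP => -[p]; rewrite inE => ps /perm_inj e.
  by rewrite -e ltnn in ps.
apply/andP; split; first by apply: divr_ge0; [apply: sumr_ge0 => g _; case/andP: (st g)|exact: ltW].
rewrite ler_pdivrMr // -[(n`!)]card_Sn mulr_natr -sumr_const; apply: ler_sum => g _.
by case/andP: (st g).
Qed.

(** Induction on [l]: raising the shift by one changes the sum by the telescoping amount
    [g (t + l) - g l], at most [B] because both increments lie between 0 and [B]. *)
Lemma sum_shift_le (t l : nat) : (t + l <= n)%N ->
  \sum_(m < t) ((set_mean (m + l).+1 - set_mean (m + l)) - (set_mean m.+1 - set_mean m))
    <= l%:R * B.
Proof.
pose g m := set_mean m.+1 - set_mean m; rewrite -/(g _).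
elim: l => [|l IH] tl; first by rewrite mul0r big1 // => m _; rewrite addn0 subrr.
have tl' : (t + l < n)%N by rewrite -addnS.
have -> : \sum_(m < t) (g (m + l.+1)%N - g m) =
    (g (t + l)%N - g l) + \sum_(m < t) (g (m + l)%N - g m).
  have -> : g (t + l)%N - g l = \sum_(m < t) (g (m.+1 + l)%N - g (m + l)%N).
    rewrite -(big_mkord xpredT (fun m => g (m.+1 + l)%N - g (m + l)%N)).
    by rewrite (telescope_sumr (fun m => g (m + l)%N)).
  by rewrite -big_split; apply: eq_bigr => m _; rewrite /= addnS addSn; ring.
rewrite -natr1 mulrDl mul1r addrC; apply: lerD; first exact/IH/ltnW.
have /andP[_ h1] := set_mean_step tl'.
have /andP[h2 _] := set_mean_step (leq_ltn_trans (leq_addl t l) tl').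
by rewrite /g; lra.
Qed.

(* Both set_mean (m + k) - set_mean m and k (set_mean m.+1 - set_mean m) are sums of k increments
   of set_mean, and the sums over m of the increments at m + l and at m telescope up to 2 l
   boundary terms. *)
Lemma sum_multi_mean_le (t k : nat) : (t + k <= n)%N -> 0 <= B ->
  \sum_(m < t) (set_mean (m + k) - set_mean m - k%:R * (set_mean m.+1 - set_mean m))
    <= k%:R ^+ 2 * B.
Proof.
move=> tk B0.
have -> : \sum_(m < t) (set_mean (m + k) - set_mean m - k%:R * (set_mean m.+1 - set_mean m)) =
   \sum_(l < k) \sum_(m < t)
     ((set_mean (m + l).+1 - set_mean (m + l)) - (set_mean m.+1 - set_mean m)).
  rewrite exchange_big; apply: eq_bigr => m _; rewrite sumrB sumr_const card_ord mulr_natl.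
  congr (_ - _); under [RHS]eq_bigr do rewrite -addnS.
  by rewrite -(big_mkord xpredT (fun l => set_mean (m + l.+1) - set_mean (m + l)))
    (telescope_sumr (fun l => set_mean (m + l))) // addn0.
rewrite expr2 -mulrA mulr_natl -[X in _ *+ X]card_ord -sumr_const; apply: ler_sum => l _.
apply: le_trans (sum_shift_le _) _; first by apply: leq_trans tk; rewrite leq_add2l ltnW.
by rewrite ler_wpM2r // ler_nat ltnW.
Qed.

Lemma small_multi_mean (t k : nat) : (0 < t)%N -> (t + k <= n)%N -> 0 <= B ->
  exists2 m : nat, (m < t)%N &
  avg (fun j : {ffun 'I_m -> 'I_n} => injectiveb j)
    (fun j => avg (fun i : {ffun 'I_k -> compl j} => injectiveb i)
      (fun i => G (tuple_set j :|: tuple_set (ffval i)) - G (tuple_set j)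
        - \sum_l (G (ffval i l |: tuple_set j) - G (tuple_set j))))
  <= k%:R ^+ 2 * B / t%:R.
Proof.
move=> t0 tk B0.
have t0' : 0 < t%:R :> R by rewrite ltr0n.
have [m hm] : exists m : 'I_t,
    set_mean (m + k) - set_mean m - k%:R * (set_mean m.+1 - set_mean m) <= k%:R ^+ 2 * B / t%:R.
  (* Pigeonhole: if all [t] terms exceeded the [t]-th part of the bound, their sum would exceed the
     bound. *)
  apply/existsP; apply: contraT; rewrite negb_exists => /forallP h.
  have := sum_multi_mean_le tk B0; rewrite leNgt => /negP; case.
  rewrite -[X in X < _](divfK (lt0r_neq0 t0')) mulr_natr -[X in _ *+ X]card_ord -sumr_const.
  apply: ltr_sum => [|m _]; last by rewrite ltNge.
  by apply/hasP; exists (Ordinal t0); rewrite ?mem_index_enum.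
exists m => //; apply: le_trans hm.
have mkn : (m + k <= n)%N by apply: leq_trans tk; rewrite leq_add2r ltnW.
rewrite (avg_tuple_mean (fun j i => G (tuple_set j :|: tuple_set i) - G (tuple_set j)
        - \sum_l (G (i l |: tuple_set j) - G (tuple_set j)))).
(* Each family of index sets is permutation-equivariant and of constant size [m + k], [m] or [m.+1],
   so its mean is a value of [set_mean]. *)
rewrite !tuple_meanB tuple_mean_sum.
rewrite (tuple_mean_set (s := (m + k)%N)) //; last first.
- move=> j i /injectiveP ji /andP[/injectiveP ii /forallP nj].
  rewrite cardsU !card_tuple_set // (_ : _ :&: _ = set0) ?cards0 ?subn0 //.
  apply/setP => p; rewrite !inE; apply/negP => /andP[/imsetP[o _ po] /imsetP[l _ pl]].
  by have := nj l; rewrite -pl po codom_f.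
- by move=> g j i; rewrite imsetU !tuple_set_act.
have e : tuple_mean (fun (j : {ffun 'I_m -> 'I_n}) (_ : {ffun 'I_k -> 'I_n}) =>
    G (tuple_set j)) = set_mean m.
  apply: tuple_mean_set => // [g j _|j i /injectiveP ji _]; first exact: tuple_set_act.
  exact: card_tuple_set.
rewrite e lerD2l lerN2 (eq_bigr (fun _ => set_mean m.+1 - set_mean m)) => [|l _].
  by rewrite sumr_const card_ord mulr_natl.
rewrite tuple_meanB e; congr (_ - _); apply: tuple_mean_set => // [g j i|j i /injectiveP ji].
  by rewrite imsetU1 tuple_set_act ffunE.
case/andP => _ /forallP nj; rewrite cardsU1 card_tuple_set // (_ : _ \notin _) //.
by apply: contra (nj l) => /imsetP[o _ ->]; rewrite codom_f.
Qed.

End RandomTuples.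

(** * Trace norm and positive operators *)

Section Operators.
Variable R : realType.
Local Notation C := (complex R).

Lemma char_poly_conj (F : fieldType) (n : nat) (P A D : 'M[F]_n) :
  P \in unitmx -> A = invmx P *m D *m P -> char_poly A = char_poly D.
Proof.
move=> Pu ->; rewrite /char_poly; set P' := map_mx polyC P.
have dP : \det P' != 0 by rewrite det_map_mx polyC_eq0 -unitfE -unitmxE.
have e : P' *m char_poly_mx (invmx P *m D *m P) = char_poly_mx D *m P'.
  rewrite /char_poly_mx mulmxBr mulmxBl; congr (_ - _); first by rewrite scalar_mxC.
  by rewrite -!map_mxM -!mulmxA mulKVmx.
by move/(congr1 determinant): e; rewrite !det_mulmx mulrC => /(mulIf dP).
Qed.

Lemma prod_XsubC_perm (F : fieldType) (s s' : seq F) :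
  \prod_(a <- s) ('X - a%:P) = \prod_(a <- s') ('X - a%:P) -> perm_eq s s'.
Proof. by move=> e; apply/allP => x _ /=; rewrite -!mu_prod_XsubC e. Qed.

Definition absq (n : nat) (M : 'M[C]_n) : 'M[C]_n := (map_mx Num.conj M)^T *m M.

Lemma absq_normal n (M : 'M[C]_n) : absq M \is normalmx.
Proof.
apply/hermitian_normalmx/is_hermitianmxP; rewrite expr0 scale1r.
apply/matrixP => i j; rewrite !mxE rmorph_sum; apply: eq_bigr => k _.
by rewrite !mxE rmorphM /= conjCK mulrC.
Qed.

Lemma absq_spectral n (M : 'M[C]_n) (P := spectralmx (absq M)) :
  absq M = invmx P *m diag_mx (spectral_diag (absq M)) *m P.
Proof. exact/orthomx_spectralP/absq_normal. Qed.

(** Diagonalising by the unitary [P] gives the Gram matrix of the columns of [M] times the adjoint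
    of [P]; its diagonal entries are sums of squared moduli. *)
Lemma absq_spectral_ge0 n (M : 'M[C]_n) i : 0 <= spectral_diag (absq M) 0 i.
Proof.
pose P := spectralmx (absq M); have Pu : P \is unitarymx := spectral_unitarymx _.
have e : diag_mx (spectral_diag (absq M)) = P *m absq M *m invmx P.
  by rewrite [in RHS]absq_spectral !mulmxA mulmxV ?spectral_unit // mul1mx mulmxK ?spectral_unit.
have -> : spectral_diag (absq M) 0 i = diag_mx (spectral_diag (absq M)) i i.
  by rewrite mxE eqxx mulr1n.
rewrite e invmx_unitary // /absq.
have -> : P *m ((map_mx Num.conj M)^T *m M) *m map_mx Num.conj P^T =
  map_mx Num.conj (M *m map_mx Num.conj P^T)^T *m (M *m map_mx Num.conj P^T).
  rewrite trmx_mul map_mxM !mulmxA; congr (_ *m _ *m _ *m _); last by rewrite map_trmx.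
  by apply/matrixP => k l; rewrite !mxE /= conjCK.
rewrite mxE; apply: sumr_ge0 => k _; rewrite !mxE mulrC; exact: mul_conjC_ge0.
Qed.

Lemma Re_ge0 (z : C) : 0 <= z -> 0 <= complex.Re z.
Proof. by rewrite lecE => /andP[]. Qed.

Lemma trnorm_ge0 (T : finType) (A : op R T) : 0 <= trnorm A.
Proof.
by apply/Re_ge0/sumr_ge0 => i _; rewrite sqrtC_ge0; apply: absq_spectral_ge0.
Qed.

(** The order in which [spectral_diag] lists eigenvalues is unknown, so they are compared with the
    squares of [f] as multisets, through the characteristic polynomial. *)
Lemma trnorm_diag (T : finType) (A : op R T) (f : T -> R) :
  (forall a b, A a b = (a == b)%:R * (f a)%:C%C) -> trnorm A = \sum_a `|f a|.
Proof.
move=> Af; rewrite /trnorm -/(absq _); set H := absq _.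
pose g (i : 'I_#|T|) : C := (f (enum_val i) ^+ 2)%:C%C.
have Hd : H = diag_mx (\row_i g i).
  apply/matrixP => i j; rewrite !mxE (bigD1 i) //= big1 => [|k ki].
    rewrite !mxE !Af (inj_eq enum_val_inj) eqxx mul1r addr0.
    have -> : Num.conj ((f (enum_val i))%:C%C : C) = (f (enum_val i))%:C%C by exact: conjc_real.
    rewrite (inj_eq enum_val_inj); case: eqP => [_|_]; last by rewrite mul0r mulr0 mulr0n.
    by rewrite mul1r mulr1n /g -rmorphM.
  by rewrite !mxE Af (inj_eq enum_val_inj) (negPf ki) mul0r rmorph0 mul0r.
have pe : perm_eq [seq spectral_diag H 0 i | i : 'I_#|T|] [seq g i | i : 'I_#|T|].
  apply: prod_XsubC_perm; rewrite !big_image /=.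
  have cp (D : 'rV[C]_#|T|) : char_poly (diag_mx D) = \prod_i ('X - (D 0 i)%:P).
    rewrite char_poly_trig ?diag_mx_is_trig //; apply: eq_bigr => i _.
    by rewrite mxE eqxx mulr1n.
  rewrite -cp -(char_poly_conj (spectral_unit _) (absq_spectral _)) -/H Hd cp.
  by apply: eq_bigr => i _; rewrite mxE.
have -> : \sum_i sqrtC (spectral_diag H 0 i) = (\sum_a `|f a|)%:C%C.
  have -> : \sum_i sqrtC (spectral_diag H 0 i) =
      \sum_(z <- [seq spectral_diag H 0 i | i : 'I_#|T|]) sqrtC z by rewrite big_image.
  rewrite (perm_big _ pe) big_image /=.
  rewrite rmorph_sum [RHS](reindex_onto enum_val enum_rank) /=; last first.
    by move=> *; rewrite enum_rankK.
  apply: eq_big => [i|i _]; first by rewrite enum_valK eqxx.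
  by rewrite /g -real_normK ?num_real // rmorphXn sqrCK // ler0c.
by [].
Qed.

(** * Rank-one decomposition of positive operators *)

Section Gram.
Variables (T : finType) (A : op R T).

(** The [i]-th eigenvector of [A], scaled by the square root of its eigenvalue. *)
Definition gram (i : 'I_#|T|) (a : T) : C :=
  Num.conj (spectralmx (mx_of_op A) i (enum_rank a)) * sqrtC (spectral_diag (mx_of_op A) 0 i).

Hypothesis A_psd : psd_op A.

Lemma sum_enum_val (F : T -> C) : \sum_(i < #|T|) F (enum_val i) = \sum_a F a.
Proof.
rewrite [RHS](reindex_onto enum_val enum_rank) /=; last by move=> *; rewrite enum_rankK.
by apply: eq_bigl => i; rewrite enum_valK eqxx.
Qed.

Lemma gramE a b : A a b = \sum_i gram i a * Num.conj (gram i b).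
Proof.
case: A_psd => Ah Ap; set M := mx_of_op A; set P := spectralmx M.
have Pu : P \is unitarymx := spectral_unitarymx _.
have Mn : M \is normalmx.
  apply/hermitian_normalmx/is_hermitianmxP; rewrite expr0 scale1r; apply/matrixP => i j.
  by rewrite !mxE Ah.
have Ms : M = invmx P *m diag_mx (spectral_diag M) *m P by exact/orthomx_spectralP.
have e : diag_mx (spectral_diag M) = P *m M *m invmx P.
  by rewrite [in RHS]Ms !mulmxA mulmxV ?spectral_unit // mul1mx mulmxK ?spectral_unit.
rewrite invmx_unitary // in Ms e.
(* An eigenvalue is the quadratic form of [A] at its eigenvector, the conjugate of row [i] of
   [P]. *)
have D0 i : 0 <= spectral_diag M 0 i.
  have -> : spectral_diag M 0 i = diag_mx (spectral_diag M) i i by rewrite mxE eqxx mulr1n.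
  rewrite e mxE.
  have := Ap (fun a => Num.conj (P i (enum_rank a))).
  rewrite exchange_big /= -(sum_enum_val (fun b => \sum_a _)) => /le_trans; apply.
  rewrite le_eqVlt; apply/orP; left; apply/eqP; apply: eq_bigr => k _; rewrite !mxE mulr_suml.
  rewrite -sum_enum_val; apply: eq_bigr => l _.
  by rewrite !mxE !enum_valK conjCK.
have -> : A a b = M (enum_rank a) (enum_rank b) by rewrite mxE !enum_rankK.
rewrite [in LHS]Ms mxE; apply: eq_bigr => i _; rewrite mul_mx_diag !mxE /gram -/M -/P.
rewrite rmorphM /= conjCK (@geC0_conj _ (sqrtC _)) ?sqrtC_ge0 //.
rewrite -[X in _ * X * _]sqrtCK expr2; ring.
Qed.

(** Writing [A] as the sum of the rank-one operators of the [gram i], the quadratic form at [v]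
    becomes the sum over [i] of the Cauchy-Schwarz defects of [v] and [gram i]. *)
Lemma trace_sub_psd : psd_op (fun a b => (a == b)%:R * trace_op A - A a b).
Proof.
have [Ah Ap] := A_psd; split.
  move=> a b; rewrite rmorphB rmorphM rmorph_nat eq_sym Ah; congr (_ * _ - _).
  by rewrite /trace_op rmorph_sum; apply: eq_bigr => c _; rewrite /= -Ah.
move=> v.
have -> : \sum_a \sum_b Num.conj (v a) * ((a == b)%:R * trace_op A - A a b) * v b =
    \sum_i ((\sum_a `|gram i a| ^+ 2) * (\sum_a `|v a| ^+ 2)
      - `|\sum_a Num.conj (v a) * gram i a| ^+ 2).
  rewrite sumrB -mulr_suml.
  have -> : \sum_i \sum_a `|gram i a| ^+ 2 = trace_op A.
    rewrite exchange_big; apply: eq_bigr => a _; rewrite gramE.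
    by apply: eq_bigr => i _; rewrite normCK.
  have -> : \sum_i `|\sum_a Num.conj (v a) * gram i a| ^+ 2 =
      \sum_a \sum_b Num.conj (v a) * A a b * v b.
    under [RHS]eq_bigr do under eq_bigr do rewrite gramE mulr_sumr mulr_suml.
    under [RHS]eq_bigr do rewrite exchange_big.
    rewrite [RHS]exchange_big; apply: eq_bigr => i _.
    rewrite normCK rmorph_sum mulr_suml; apply: eq_bigr => a _.
    by rewrite mulr_sumr; apply: eq_bigr => b _; rewrite rmorphM /= conjCK; ring.
  rewrite mulr_sumr -sumrB; apply: eq_bigr => a _.
  under eq_bigr do rewrite mulrBr mulrBl.
  rewrite sumrB; congr (_ - _); rewrite (bigD1 a) //= eqxx big1 => [|b ba].
    by rewrite normCK mul1r; ring.
  by rewrite eq_sym (negPf ba) mul0r mulr0 mul0r.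
apply: sumr_ge0 => i _; rewrite subr_ge0.
apply: (@le_trans _ _ ((\sum_a `|v a| * `|gram i a|) ^+ 2)).
  rewrite ler_sqr ?nnegrE //; last by apply: sumr_ge0 => a _; exact: mulr_ge0.
  apply: le_trans (ler_norm_sum _ _ _) _; apply: ler_sum => a _.
  by rewrite normrM norm_conjC.
by rewrite [leRHS]mulrC; apply: sum_mul_sqr_le => a; apply: normr_real.
Qed.
End Gram.

End Operators.

(** * Local measurements *)

Section LocalTrace.
Variables (R : realType) (d : nat).
Local Notation C := (complex R).

(* tr ((bigotimes_p A_p) rho) *)
Definition local_trace (L : finType) (rho : op R (cfg L d)) (A : L -> op R 'I_d) : C :=
  \sum_(u : cfg L d) \sum_(v : cfg L d) (\prod_p A p (v p) (u p)) * rho u v.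

Definition id_op : op R 'I_d := fun a b => (a == b)%:R.

Lemma eq_local_trace (L : finType) (rho : op R (cfg L d)) (A A' : L -> op R 'I_d) :
  (forall p a b, A p a b = A' p a b) -> local_trace rho A = local_trace rho A'.
Proof.
move=> e; apply: eq_bigr => u _; apply: eq_bigr => v _; congr (_ * _).
by apply: eq_bigr => p _.
Qed.

(** Decomposing every factor by [gramE] and distributing the product, the trace becomes a sum of
    quadratic forms of [rho] at the product vectors [V f]. *)
Lemma local_trace_ge0 (L : finType) (rho : op R (cfg L d)) (A : L -> op R 'I_d) :
  psd_op rho -> (forall p, psd_op (A p)) -> 0 <= local_trace rho A.
Proof.
move=> [_ rp] Ap.
pose V (f : {ffun L -> 'I_#|'I_d|}) (u : cfg L d) : C := \prod_p gram (A p) (f p) (u p).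
have -> : local_trace rho A = \sum_f \sum_u \sum_v Num.conj (V f u) * rho u v * V f v.
  rewrite exchange_big; apply: eq_bigr => u _; rewrite exchange_big; apply: eq_bigr => v _.
  rewrite (eq_bigr (fun p => \sum_o gram (A p) o (v p) * Num.conj (gram (A p) o (u p)))).
    rewrite bigA_distr_bigA mulr_suml; apply: eq_bigr => f _.
    by rewrite big_split /= -rmorph_prod -/(V f u) -/(V f v); ring.
  by move=> p _; apply: gramE.
by apply: sumr_ge0 => f _; apply: rp.
Qed.

Lemma local_trace_lin (L : finType) (rho : op R (cfg L d)) (p : L) (c : C)
    (A A1 A2 : L -> op R 'I_d) :
  (forall o, o != p -> A1 o = A o /\ A2 o = A o) ->
  (forall a b, A p a b = c * A1 p a b - A2 p a b) ->
  local_trace rho A = c * local_trace rho A1 - local_trace rho A2.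
Proof.
move=> Ao Ap; rewrite mulr_sumr -sumrB; apply: eq_bigr => u _.
rewrite mulr_sumr -sumrB; apply: eq_bigr => v _.
have D A' : \prod_o A' o (v o) (u o) = A' p (v p) (u p) * \prod_(o | o != p) A' o (v o) (u o) :> C.
  by rewrite (bigD1 p).
rewrite !D Ap.
have -> : \prod_(o | o != p) A1 o (v o) (u o) = \prod_(o | o != p) A o (v o) (u o).
  by apply: eq_bigr => o /Ao[->].
have -> : \prod_(o | o != p) A2 o (v o) (u o) = \prod_(o | o != p) A o (v o) (u o).
  by apply: eq_bigr => o /Ao[_ ->].
by ring.
Qed.

(** Distributivity: an event that constrains each site separately has a product effect. All marginal
    probabilities are computed in this way. *)
Lemma sum_local_trace (L X : finType) (M : X -> op R 'I_d) (rho : op R (cfg L d))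
    (F : L -> pred X) :
  \sum_(y : {ffun L -> X} | y \in family F) local_trace rho (fun p => M (y p)) =
  local_trace rho (fun p a b => \sum_(x | F p x) M x a b).
Proof.
rewrite exchange_big; apply: eq_bigr => u _; rewrite exchange_big; apply: eq_bigr => v _.
by rewrite bigA_distr_big_dep mulr_suml.
Qed.

(** Partial traces sum over configurations with prescribed restrictions; a further sum over the
    restrictions removes the constraints. *)
Lemma sum_fibers (I J U V : finType) (f : U -> I) (g : V -> J) (K : I -> J -> U -> V -> C) :
  \sum_a \sum_b \sum_u \sum_(v | (f u == a) && (g v == b)) K a b u v =
  \sum_u \sum_v K (f u) (g v) u v.
Proof.
under eq_bigr do rewrite exchange_big.
rewrite exchange_big; apply: eq_bigr => u _ /=.
rewrite (bigD1 (f u)) //= [X in _ + X]big1 ?addr0 => [|a au]; last first.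
  by rewrite big1 // => b _; rewrite big_pred0 // => v; rewrite eq_sym (negPf au).
rewrite (exchange_big_dep xpredT) //=; apply: eq_bigr => v _.
by rewrite (big_pred1 (g v)) // => b; rewrite eqxx eq_sym.
Qed.

(** Duality between partial trace and padding with identities: outside the range of [i] the identity
    entries multiply to the indicator [off u v] in [reduced]. *)
Lemma local_trace_reduced (L : finType) (k : nat) (i : {ffun 'I_k -> L})
    (rho : op R (cfg L d)) (B : 'I_k -> op R 'I_d) (A : L -> op R 'I_d) :
  injective i -> (forall l a b, A (i l) a b = B l a b) ->
  (forall p, p \notin codom i -> forall a b, A p a b = id_op a b) ->
  local_trace (reduced rho i) B = local_trace rho A.
Proof.
move=> ii AB Aid; pose res (u : cfg L d) : cfg 'I_k d := [ffun l => u (i l)].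
pose off (u v : cfg L d) := [forall p, (p \notin codom i) ==> (u p == v p)].
have resE (u : cfg L d) (a : cfg 'I_k d) : [forall l, u (i l) == a l] = (res u == a).
  apply/forallP/eqP => [h|<- l]; last by rewrite ffunE.
  by apply/ffunP => l; rewrite ffunE; apply/eqP.
transitivity (\sum_a \sum_b \sum_(u : cfg L d) \sum_(v : cfg L d | (res u == a) && (res v == b))
    (\prod_l B l (b l) (a l)) * rho u v * (off u v)%:R).
  apply: eq_bigr => a _; apply: eq_bigr => b _; rewrite /reduced mulr_sumr.
  apply: eq_bigr => u _; rewrite mulr_sumr big_mkcondr [in RHS]big_mkcond [in LHS]big_mkcond.
  apply: eq_bigr => v _ /=; rewrite !resE -/(off u v).
  by case: andP => // _; case: (off u v); rewrite ?mulr1 ?mulr0.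
rewrite (sum_fibers res res
  (fun a b u v => (\prod_l B l (b l) (a l)) * rho u v * (off u v)%:R)).
apply: eq_bigr => u _; apply: eq_bigr => v _; rewrite mulrAC; congr (_ * _).
rewrite [RHS](bigID (mem (codom i))) /=; congr (_ * _).
  rewrite (eq_bigl (fun p => p \in [set i l | l in 'I_k])); last first.
    by move=> p; apply/codomP/imsetP => [[l ->]|[l _ ->]]; exists l.
  rewrite big_imset /=; last by move=> ? ? _ _; apply: ii.
  by apply: eq_bigr => l _; rewrite AB !ffunE.
have [/forall_inP h|] := boolP (off u v).
  by rewrite big1 // => p pi; rewrite Aid // /id_op (eqP (h p pi)) eqxx.
rewrite negb_forall => /existsP[p]; rewrite negb_imply => /andP[pi uv].
by rewrite (bigD1 p) //= Aid // /id_op eq_sym (negPf uv) mul0r.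
Qed.

Lemma local_trace_post (X : finType) (n m : nat) (M : X -> op R 'I_d)
    (rho : op R (cfg 'I_n d)) (j : {ffun 'I_m -> 'I_n}) (x : {ffun 'I_m -> X})
    (A : compl j -> op R 'I_d) (A' : 'I_n -> op R 'I_d) :
  injective j -> (forall l, A' (j l) = M (x l)) -> (forall p : compl j, A' (val p) = A p) ->
  local_trace (post_state M rho j x) A = local_trace rho A' / (outcome_prob M rho j x)%:C%C.
Proof.
move=> ji Aj Ac; pose res (u : cfg 'I_n d) : cfg (compl j) d := [ffun p => u (val p)].
have resE (u : cfg 'I_n d) (a : cfg (compl j) d) :
    [forall p : compl j, u (val p) == a p] = (res u == a).
  apply/forallP/eqP => [h|<- l]; last by rewrite ffunE.
  by apply/ffunP => l; rewrite ffunE; apply/eqP.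
pose K (a b : cfg (compl j) d) (u v : cfg 'I_n d) : C :=
  (\prod_p A p (b p) (a p)) * ((\prod_l M (x l) (v (j l)) (u (j l))) * rho u v)
   / (outcome_prob M rho j x)%:C%C.
transitivity (\sum_a \sum_b \sum_u \sum_(v | (res u == a) && (res v == b)) K a b u v).
  apply: eq_bigr => a _; apply: eq_bigr => b _; rewrite /post_state mulrA mulr_sumr mulr_suml.
  apply: eq_bigr => u _; rewrite mulr_sumr mulr_suml.
  by apply: eq_bigl => v; rewrite !resE.
rewrite (sum_fibers res res K) mulr_suml; apply: eq_bigr => u _; rewrite mulr_suml.
apply: eq_bigr => v _; rewrite /K mulrA; congr (_ * _ / _).
rewrite [RHS](bigID (mem (codom j))) /= mulrC; congr (_ * _).
  rewrite [RHS](eq_bigl (fun p => p \in [set j l | l in 'I_m])); last first.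
    by move=> p; apply/codomP/imsetP => [[l ->]|[l _ ->]]; exists l.
  rewrite big_imset /=; last by move=> ? ? _ _; apply: ji.
  by apply: eq_bigr => l _; rewrite Aj.
rewrite (eq_bigl (fun p => p \in [set val o | o in {: compl j}])); last first.
  move=> p; apply/idP/imsetP => [pj|[[o oj] _ ->]] //.
  by exists (exist (fun p => p \notin codom j) p pj : compl j).
rewrite big_imset /=; last by move=> ? ? _ _; apply: val_inj.
by apply: eq_bigr => p _; rewrite -Ac !ffunE.
Qed.

Lemma trace_opE (L : finType) (rho : op R (cfg L d)) :
  trace_op rho = local_trace rho (fun _ => id_op).
Proof.
apply: eq_bigr => u _; rewrite (bigD1 u) //= [X in _ + X]big1 ?addr0 => [|v vu].
  by rewrite big1 ?mul1r // => p _; rewrite /id_op eqxx.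
have /existsP[p up] : [exists p, v p != u p].
  rewrite -negb_forall; apply: contra vu => /forallP h.
  by apply/eqP/ffunP => p; apply/eqP.
by rewrite (bigD1 p) //= /id_op (negPf up) !mul0r.
Qed.

Lemma sum_cfg1 (F : cfg 'I_1 d -> C) : \sum_a F a = \sum_(c : 'I_d) F [ffun _ => c].
Proof.
rewrite (reindex (fun c : 'I_d => [ffun _ => c] : cfg 'I_1 d)) //.
exists (fun a : cfg 'I_1 d => a ord0) => [c _|a _]; first by rewrite ffunE.
by apply/ffunP => o; rewrite ffunE (ord1 o).
Qed.

Lemma local_trace_prod_marg (L : finType) (k : nat) (i : {ffun 'I_k -> L})
    (rho : op R (cfg L d)) (B : 'I_k -> op R 'I_d) (A : 'I_k -> L -> op R 'I_d) :
  (forall l a b, A l (i l) a b = B l a b) ->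
  (forall l p, p != i l -> forall a b, A l p a b = id_op a b) ->
  local_trace (prod_marg rho i) B = \prod_l local_trace rho (A l).
Proof.
move=> AB Aid.
transitivity (\prod_l \sum_a \sum_b B l b a *
    marg1 rho (i l) [ffun _ : 'I_1 => a] [ffun _ : 'I_1 => b]).
  rewrite bigA_distr_bigA; apply: eq_bigr => a _; rewrite bigA_distr_bigA.
  by apply: eq_bigr => b _; rewrite big_split.
apply: eq_bigr => l _.
rewrite -(@local_trace_reduced _ 1 [ffun _ => i l] rho (fun _ => B l)).
- rewrite /local_trace [RHS]sum_cfg1; apply: eq_bigr => a _; rewrite [RHS]sum_cfg1.
  by apply: eq_bigr => b _; rewrite big_ord1 !ffunE.
- by move=> o o' _; rewrite (ord1 o) (ord1 o').
- by move=> o a b; rewrite ffunE AB.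
move=> p pi; apply: Aid; apply: contra pi => /eqP ->.
by apply/codomP; exists ord0; rewrite ffunE.
Qed.

Lemma reduced_herm (L : finType) (k : nat) (i : {ffun 'I_k -> L}) (rho : op R (cfg L d)) :
  herm_op rho -> herm_op (reduced rho i).
Proof.
move=> rh a b; rewrite rmorph_sum /reduced.
under [RHS]eq_bigr do rewrite rmorph_sum big_mkcond.
under [LHS]eq_bigr do rewrite big_mkcond.
rewrite exchange_big; apply: eq_bigr => u _; apply: eq_bigr => v _ /=.
rewrite rh [X in X && _]andbC.
have -> : [forall p, (p \notin codom i) ==> (v p == u p)] =
    [forall p, (p \notin codom i) ==> (u p == v p)].
  by apply: eq_forallb => p; rewrite eq_sym.
by [].
Qed.

Lemma prod_marg_herm (L : finType) (k : nat) (i : {ffun 'I_k -> L}) (rho : op R (cfg L d)) :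
  herm_op rho -> herm_op (prod_marg rho i).
Proof.
move=> rh a b; rewrite /prod_marg rmorph_prod; apply: eq_bigr => l _.
exact: reduced_herm.
Qed.

Lemma post_state_herm (X : finType) (n m : nat) (M : X -> op R 'I_d)
    (rho : op R (cfg 'I_n d)) (j : {ffun 'I_m -> 'I_n}) (x : {ffun 'I_m -> X}) :
  herm_op rho -> (forall c, herm_op (M c)) -> herm_op (post_state M rho j x).
Proof.
move=> rh Mh a b; rewrite /post_state rmorphM fmorphV [in RHS]/=.
have -> : Num.conj ((outcome_prob M rho j x)%:C%C : C) = (outcome_prob M rho j x)%:C%C.
  exact: conjc_real.
congr (_ / _); rewrite rmorph_sum.
under [RHS]eq_bigr do rewrite rmorph_sum big_mkcond.
under [LHS]eq_bigr do rewrite big_mkcond.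
rewrite exchange_big; apply: eq_bigr => u _; apply: eq_bigr => v _ /=.
rewrite andbC; case: ifP => // _; rewrite rmorphM rmorph_prod /= -rh; congr (_ * _).
by apply: eq_bigr => l _; rewrite Mh.
Qed.

End LocalTrace.

(** * Outcome distribution of the full measurement and its marginals *)

Section Measurement.
Variables (R : realType) (d n : nat) (X : finType) (rho : op R (cfg 'I_n d)) (M : X -> op R 'I_d).
Local Notation C := (complex R).
Hypothesis d_gt1 : (2 <= d)%N.
Hypothesis rho_state : is_state rho.
Hypothesis M_povm : is_povm M.

(* Joint outcome distribution when all n qudits are measured; every probability in the theorem
   is a marginal of it. *)
Definition outcome_dist (y : {ffun 'I_n -> X}) : R :=
  complex.Re (local_trace rho (fun p => M (y p))).

(** The outcome distribution of the measurement on the maximally mixed qudit. *)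
Definition trace_weight (c : X) : R := complex.Re (trace_op (M c)) / d%:R.

Lemma id_op_psd : psd_op (@id_op R d).
Proof.
split=> [a b|v]; first by rewrite /id_op rmorph_nat eq_sym.
apply: sumr_ge0 => a _; rewrite (bigD1 a) //= big1 => [|b ba].
  by rewrite /id_op eqxx mulr1 addr0 mulrC mul_conjC_ge0.
by rewrite /id_op eq_sym (negPf ba) mulr0 mul0r.
Qed.

Lemma trace_psd_ge0 (T : finType) (A : op R T) : psd_op A -> 0 <= trace_op A.
Proof.
move=> Ap; apply: sumr_ge0 => a _; rewrite gramE //; apply: sumr_ge0 => i _.
exact: mul_conjC_ge0.
Qed.

Lemma Re_ge0K (z : C) : 0 <= z -> (complex.Re z)%:C%C = z.
Proof. by move=> z0; rewrite RRe_real ?ger0_real. Qed.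

Lemma outcome_distE y : (outcome_dist y)%:C%C = local_trace rho (fun p => M (y p)).
Proof.
by apply/Re_ge0K/local_trace_ge0 => [|p]; [case: rho_state | case: M_povm].
Qed.

Lemma outcome_dist_ge0 y : 0 <= outcome_dist y.
Proof. by apply/Re_ge0/local_trace_ge0 => [|p]; [case: rho_state | case: M_povm]. Qed.

Lemma sum_outcome_dist (E : pred {ffun 'I_n -> X}) (F : 'I_n -> pred X) (B : 'I_n -> op R 'I_d) :
  (forall y, E y = (y \in family F)) -> (forall p a b, \sum_(c | F p c) M c a b = B p a b) ->
  (\sum_(y | E y) outcome_dist y)%:C%C = local_trace rho B.
Proof.
move=> EF FB; rewrite rmorph_sum (eq_bigl _ _ EF).
rewrite (eq_bigr _ (fun y _ => outcome_distE y)).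
by rewrite sum_local_trace; apply: eq_local_trace.
Qed.

Lemma outcome_dist_sum1 : \sum_y outcome_dist y = 1.
Proof.
apply: complexI; rewrite (@sum_outcome_dist _ (fun _ => predT) (fun _ => @id_op R d)).
- by rewrite -trace_opE; case: rho_state.
- by move=> y; apply/esym/familyP.
- by case: M_povm => _ h p a b; rewrite h.
Qed.

Lemma d_neq0 : d%:R != 0 :> R.
Proof. by rewrite pnatr_eq0 -lt0n ltnW. Qed.

Lemma trace_weight_ge0 c : 0 <= trace_weight c.
Proof. by rewrite divr_ge0 ?ler0n //; apply/Re_ge0/trace_psd_ge0; case: M_povm. Qed.

Lemma trace_weight_sum1 : \sum_c trace_weight c = 1.
Proof.
rewrite -mulr_suml; apply: (canLR (mulfK d_neq0)); rewrite mul1r; apply: complexI.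
rewrite rmorph_sum rmorph_nat.
rewrite (eq_bigr (fun c => trace_op (M c))) => [|c _]; last first.
  by apply/Re_ge0K/trace_psd_ge0; case: M_povm.
rewrite exchange_big /=; case: M_povm => _ h.
by under eq_bigr do rewrite h eqxx; rewrite sumr_const card_ord.
Qed.

Lemma trace_weightE c : (d%:R * trace_weight c)%:C%C = trace_op (M c).
Proof.
by rewrite mulrC divfK ?d_neq0 // Re_ge0K //; apply: trace_psd_ge0; case: M_povm.
Qed.

Definition partial_povm (S : {set 'I_n}) (y : {ffun 'I_n -> X}) (p : 'I_n) : op R 'I_d :=
  if p \in S then M (y p) else @id_op R d.

Lemma marg_outcome S y : (marg outcome_dist S y)%:C%C = local_trace rho (partial_povm S y).
Proof.
apply: (@sum_outcome_dist _ (fun p c => (p \in S) ==> (c == y p))) => [z|p a b].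
  by apply/forallP/familyP => h p; apply: h.
rewrite /partial_povm; case: (p \in S) => /=; first by rewrite big_pred1_eq.
by case: M_povm => _ ->.
Qed.

Lemma partial_povm_psd S y p : psd_op (partial_povm S y p).
Proof.
by rewrite /partial_povm; case: ifP => _; [case: M_povm | exact: id_op_psd].
Qed.

(* Since M_c <= tr(M_c) I, measuring one more qudit costs at most the factor tr(M_c). *)
Lemma marg_outcome_dom (S : {set 'I_n}) p y : p \notin S ->
  marg outcome_dist (p |: S) y <= d%:R * trace_weight (y p) * marg outcome_dist S y.
Proof.
move=> pS; rewrite -subr_ge0 -ler0c.
have -> : (d%:R * trace_weight (y p) * marg outcome_dist S y - marg outcome_dist (p |: S) y)%:C%C =
    (d%:R * trace_weight (y p))%:C%C * (marg outcome_dist S y)%:C%C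
    - (marg outcome_dist (p |: S) y)%:C%C by rewrite -rmorphM -rmorphB.
rewrite trace_weightE !marg_outcome.
pose A o := if o == p then (fun a b => (a == b)%:R * trace_op (M (y p)) - M (y p) a b)
  else partial_povm S y o.
(* By linearity in the factor at [p], the difference is the local trace with the positive operator
   tr(M) I - M at that site. *)
rewrite -(@local_trace_lin _ _ _ rho p _ A).
- apply: local_trace_ge0 => [|o]; first by case: rho_state.
  rewrite /A; case: eqP => _; last exact: partial_povm_psd.
  by apply: trace_sub_psd; case: M_povm.
- move=> o op; rewrite /A (negPf op); split=> //.
  by rewrite /partial_povm in_setU1 (negPf op).
by move=> a b; rewrite /A eqxx /partial_povm setU11 (negPf pS) mulrC.
Qed.

(** * Post-measurement states as conditional distributions *)

Section Conditioned.
Variables (m k : nat) (j : {ffun 'I_m -> 'I_n}) (x : {ffun 'I_m -> X})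
  (i : {ffun 'I_k -> compl j}).
Hypothesis j_inj : injective j.
Hypothesis i_inj : injective i.

(** The event that [j] yields [x], in the site-by-site form required by [sum_outcome_dist]. *)
Definition fix_j (p : 'I_n) (c : X) := [forall l, (j l == p) ==> (c == x l)].

Lemma fix_j_in l c : fix_j (j l) c = (c == x l).
Proof.
apply/forall_inP/eqP => [h|-> o /eqP/j_inj -> //]; exact/eqP/h.
Qed.

Lemma fix_j_out p c : p \notin codom j -> fix_j p c.
Proof. by move=> pj; apply/forall_inP => l /eqP jl; rewrite -jl codom_f in pj. Qed.

Lemma fix_jE y : (pull j y == x) = [forall p, fix_j p (y p)].
Proof.
apply/eqP/forallP => [e p|h].
  by apply/forall_inP => l /eqP <-; rewrite -e ffunE.
by apply/ffunP => l; rewrite ffunE; apply/eqP; rewrite -fix_j_in.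
Qed.

Lemma sum_povm a b : \sum_(c : X) M c a b = id_op R a b.
Proof. by case: M_povm => _ ->. Qed.

Lemma post_local_trace (P : 'I_n -> pred X) (A : compl j -> op R 'I_d) :
  (forall l, P (j l) =1 predT) ->
  (forall p a b, \sum_(c | P (val p) c) M c a b = A p a b) ->
  local_trace (post_state M rho j x) A =
  (\sum_(y | (pull j y == x) && [forall p, P p (y p)]) outcome_dist y)%:C%C
    / (outcome_prob M rho j x)%:C%C.
Proof.
move=> Pj PA.
(* Measured qudits carry the effect of their recorded outcome, the others the effect of [P], which
   is trivial on the range of [j]. *)
pose A' p : op R 'I_d := if [pick l | j l == p] is Some l then M (x l)
  else fun a b => \sum_(c | P p c) M c a b.
have A'j l : A' (j l) = M (x l).
  rewrite /A'; case: pickP => [o /eqP/j_inj -> //|/(_ l)]; by rewrite eqxx.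
have A'c p : p \notin codom j -> A' p = fun a b => \sum_(c | P p c) M c a b.
  move=> pj; rewrite /A'; case: pickP => // l /eqP jl; by rewrite -jl codom_f in pj.
rewrite (@sum_outcome_dist _ (fun p c => fix_j p c && P p c) A').
- rewrite -(@local_trace_post _ _ _ _ _ M rho j x (fun p => A' (val p)) A') //.
  by apply: eq_local_trace => p a b; rewrite A'c ?PA // (valP p).
- move=> y; rewrite fix_jE; apply/andP/familyP => [[/forallP h /forallP h'] p|h].
    by apply/andP.
  by split; apply/forallP => p; have /andP[] := h p.
move=> p a b; have [/codomP[l ->]|pj] := boolP (p \in codom j).
  by rewrite A'j (big_pred1 (x l)) // => c; rewrite fix_j_in Pj andbT.
by rewrite A'c //; apply: eq_bigl => c; rewrite fix_j_out.
Qed.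

Lemma outcome_probE : outcome_prob M rho j x = pr_j outcome_dist j x.
Proof.
pose A p : op R 'I_d := fun a b => \sum_(c | fix_j p c) M c a b.
rewrite /outcome_prob exchange_big -/(local_trace (reduced rho j) (fun l => M (x l))).
rewrite (@local_trace_reduced _ _ _ _ j rho _ A) //.
- rewrite -(@sum_outcome_dist (fun y => pull j y == x) fix_j A) // => y.
  by rewrite fix_jE; apply/forallP/familyP => h p; apply: h.
- by move=> l a b; rewrite /A (big_pred1 (x l)) // => c; rewrite fix_j_in.
move=> p pj a b; rewrite /A -sum_povm; apply: eq_bigl => c.
by rewrite fix_j_out.
Qed.

(** The Hermitian, traceless operator to which the distortion hypothesis is applied. *)
Definition correlation : op R (cfg 'I_k d) :=
  fun a b => reduced (post_state M rho j x) i a b - prod_marg (post_state M rho j x) i a b.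

Lemma local_trace_correlation (B : 'I_k -> op R 'I_d) : local_trace correlation B =
  local_trace (reduced (post_state M rho j x) i) B -
  local_trace (prod_marg (post_state M rho j x) i) B.
Proof.
rewrite -sumrB; apply: eq_bigr => u _; rewrite -sumrB; apply: eq_bigr => v _.
by rewrite mulrBr.
Qed.

Lemma correlation_herm : herm_op correlation.
Proof.
have [[rh _] _] := rho_state; have [Mp _] := M_povm.
have ph : herm_op (post_state M rho j x) by apply: post_state_herm => // c; case: (Mp c).
by move=> a b; rewrite /correlation (reduced_herm i ph) (prod_marg_herm i ph) rmorphB.
Qed.

Hypothesis prob_neq0 : pr_j outcome_dist j x != 0.

Lemma correlation_traceless : trace_op correlation = 0.
Proof.
rewrite trace_opE local_trace_correlation.
rewrite (@local_trace_reduced _ _ _ _ i _ _ (fun _ => @id_op R d)) //.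
rewrite (@local_trace_prod_marg _ _ _ _ i _ _ (fun _ _ => @id_op R d)) //.
have -> : local_trace (post_state M rho j x) (fun _ => @id_op R d) = 1.
  rewrite (@post_local_trace (fun _ => predT)) //.
    rewrite outcome_probE -fmorphV -rmorphM.
    rewrite (_ : \sum_(y | _) _ = pr_j outcome_dist j x) ?divff ?rmorph1 //.
    by apply: eq_bigl => y; rewrite (introT forallP) ?andbT.
  by move=> p a b; rewrite sum_povm.
by rewrite big1 ?subrr.
Qed.

Lemma local_trace_meas (x' : {ffun 'I_k -> X}) :
  local_trace correlation (fun l => M (x' l)) =
  (pr_ji outcome_dist j (ffval i) x x' / pr_j outcome_dist j x
   - \prod_l (pr_j1 outcome_dist j (ffval i) x l (x' l) / pr_j outcome_dist j x))%:C%C.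
Proof.
have notj l : ffval i l \notin codom j by rewrite ffunE (valP (i l)).
have vi : injective (ffval i) by move=> l l'; rewrite !ffunE => /val_inj/i_inj.
rewrite local_trace_correlation rmorphB; congr (_ - _).
  (* The event that the qudits of [i] yield [x'], site by site; it leaves the range of [j] free by
     [notj]. *)
  pose P p c := [forall l, (ffval i l == p) ==> (c == x' l)].
  pose A (p : compl j) : op R 'I_d := fun a b => \sum_(c | P (val p) c) M c a b.
  rewrite (@local_trace_reduced _ _ _ _ i _ _ A) //.
  - rewrite (@post_local_trace P) //.
      rewrite outcome_probE rmorphM fmorphV; congr (_%:C%C / _).
      apply: eq_bigl => y; congr (_ && _); apply/forallP/eqP => [h|e p].
        apply/ffunP => l; rewrite [LHS]ffunE; apply/eqP.
          exact: (forall_inP (h (ffval i l)) l (eqxx _)).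
      by apply/forall_inP => l /eqP <-; rewrite -e !ffunE.
    move=> l c; apply/forall_inP => l' /eqP e.
    by have := notj l'; rewrite e codom_f.
  - move=> l a b; rewrite /A (big_pred1 (x' l)) // => c.
    apply/forall_inP/eqP => [h|-> o]; first by apply/eqP/h; rewrite ffunE.
    by rewrite ffunE => /eqP/val_inj/i_inj ->.
  move=> p pi a b; rewrite /A -sum_povm; apply: eq_bigl => c.
  apply/forall_inP => l; rewrite ffunE => /eqP/val_inj e.
  by rewrite -e codom_f in pi.
(* For the product of marginals there is one event for each [l], constraining only the qudit
   [i l]. *)
pose P l p c := (ffval i l == p) ==> (c == x' l).
pose A l (p : compl j) : op R 'I_d := fun a b => \sum_(c | P l (val p) c) M c a b.
rewrite (@local_trace_prod_marg _ _ _ _ i _ _ A).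
- rewrite rmorph_prod; apply: eq_bigr => l _; rewrite (@post_local_trace (P l)) //.
    rewrite outcome_probE rmorphM fmorphV; congr (_%:C%C / _).
    apply: eq_bigl => y; congr (_ && _); apply/forallP/idP => [/(_ (ffval i l))|h p].
      by rewrite /P eqxx.
    by apply/implyP => /eqP <-.
  move=> o c; apply/implyP => /eqP e.
  by have := notj l; rewrite e codom_f.
- by move=> l a b; rewrite /A (big_pred1 (x' l)) // => c; rewrite /P ffunE eqxx.
move=> l p pi a b; rewrite /A -sum_povm; apply: eq_bigl => c.
by rewrite /P ffunE (inj_eq val_inj) eq_sym (negPf pi).
Qed.

Lemma trnorm_meas : trnorm (meas_tensor M correlation) =
  \sum_x' `|pr_ji outcome_dist j (ffval i) x x' / pr_j outcome_dist j x
   - \prod_l (pr_j1 outcome_dist j (ffval i) x l (x' l) / pr_j outcome_dist j x)|.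
Proof.
apply: trnorm_diag => y z; rewrite /meas_tensor; congr (_ * _).
by rewrite -local_trace_meas /local_trace exchange_big.
Qed.

End Conditioned.
End Measurement.

(** Covers [k = 0], where the space is one-dimensional; the distortion hypothesis speaks of positive
    [k'] only. *)
Lemma op0_traceless (R : realType) (d : nat) (xi : op R (cfg 'I_0 d)) :
  trace_op xi = 0 -> trnorm xi = 0.
Proof.
have one (a b : cfg 'I_0 d) : a = b by apply/ffunP => -[].
move=> tr0; rewrite (@trnorm_diag _ _ _ (fun _ => 0)).
  by rewrite big1 // => a _; rewrite normr0.
move=> a b; rewrite mulr0 -tr0 /trace_op (one b a) (bigD1 a) //= big1 ?addr0 // => c.
by rewrite (one c a) eqxx.
Qed.

(** * The bound on the expected squared correlation *)

Theorem theorem17 (R : realType) (d n k : nat)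
  (rho : op R (cfg 'I_n d)) (X : finType) (M : X -> op R 'I_d) :
  (2 <= d)%N ->
  is_state rho ->
  (k <= n)%N ->
  is_povm M ->
  (#|X| <= d ^ 8)%N ->
  (forall k' : nat, (0 < k')%N ->
     forall xi : op R (cfg 'I_k' d), herm_op xi -> trace_op xi = 0 ->
       trnorm xi <= (18 * d%:R) `^ (k'%:R / 2) * trnorm (meas_tensor M xi)) ->
  forall t : nat, (0 < t)%N -> (t <= n - k)%N ->
  exists m : nat, (m <= t)%N /\
    avg (fun j : {ffun 'I_m -> 'I_n} => injectiveb j)
      (fun j => \sum_(x : {ffun 'I_m -> X}) outcome_prob M rho j x *
         avg (fun i : {ffun 'I_k -> compl j} => injectiveb i)
           (fun i => trnorm (fun a b => reduced (post_state M rho j x) i a b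
                                       - prod_marg (post_state M rho j x) i a b) ^+ 2))
    <= 4 * ln (d%:R : R) * (18 * d%:R) ^+ k * (k%:R) ^+ 2 / t%:R.
Proof.
move=> d2 rhoS kn povm _ distortion t t0 tnk.
have d0 : 0 < d%:R :> R by rewrite ltr0n ltnW.
have c0 : 0 <= 18 * d%:R :> R by rewrite mulr_ge0 ?ler0n.
have distort k' (xi : op R (cfg 'I_k' d)) : herm_op xi -> trace_op xi = 0 ->
    trnorm xi <= (18 * d%:R) `^ (k'%:R / 2) * trnorm (meas_tensor M xi).
  case: k' xi => [|k'] xi xih xi0; last exact: distortion.
  by rewrite (op0_traceless xi0) mulr_ge0 ?powR_ge0 ?trnorm_ge0.
have lnd : 0 <= ln (d%:R : R) by rewrite ln_ge0 // ler1n ltnW.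
have q0 := outcome_dist_ge0 rhoS povm; have q1 := outcome_dist_sum1 rhoS povm.
have r0 := trace_weight_ge0 povm; have r1 := trace_weight_sum1 d2 povm.
have dom := fun S p y => @marg_outcome_dom R d n X rho M d2 rhoS povm S p y.
pose G := relent (outcome_dist rho M) (trace_weight M).
have step (S : {set 'I_n}) p : p \notin S -> 0 <= G (p |: S) - G S <= ln (d%:R : R).
  move=> pS; rewrite (relentU1_ge0 q0 q1 r0 r1 dom) //.
  exact: (relentU1_le q0 q1 r0 d0 dom).
have tkn : (t + k <= n)%N by rewrite addnC -leq_subRL.
have [m mt Hm] := small_multi_mean step t0 tkn lnd.
exists m; split; first exact: ltnW.
pose c : R := 4 * (18 * d%:R) ^+ k.
have c_ge0 : 0 <= c by rewrite mulr_ge0 ?exprn_ge0.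
have -> : 4 * ln (d%:R : R) * (18 * d%:R) ^+ k * k%:R ^+ 2 / t%:R =
    c * (k%:R ^+ 2 * ln d%:R / t%:R) by rewrite /c; ring.
apply: le_trans (ler_wpM2l c_ge0 Hm); rewrite -avgMl; apply: ler_avg => j /injectiveP ji.
(* The range of [i] does not depend on [x], so the two averages commute and the bound can be proved
   for each pair [j], [i]. *)
rewrite sum_mul_avg -avgMl; apply: ler_avg => i /injectiveP ii.
have vi : injective (ffval i) by move=> l l'; rewrite !ffunE => /val_inj/ii.
have notj l : ffval i l \notin [set j o | o in 'I_m].
  by rewrite ffunE; case: (i l) => p /= pj; apply/imsetP => -[o _ e]; rewrite e codom_f in pj.
have := conditional_pinsker (trace_weight M) q0 vi notj.
rewrite -(ler_pM2l (_ : 0 < (18 * d%:R) ^+ k :> R)) ?exprn_gt0 ?mulr_gt0 // mulrA.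
rewrite [_ ^+ k * 4]mulrC -/c; apply: le_trans; rewrite mulr_sumr; apply: ler_sum => x _.
rewrite outcome_probE // [leRHS]mulrCA.
(* Outcomes of probability zero, for which [post_state] divides by zero, have weight zero on both
   sides. *)
have [->|pn0] := eqVneq (pr_j (outcome_dist rho M) j x) 0; first by rewrite !mul0r.
apply: ler_wpM2l; first exact: sumr_ge0.
rewrite -(trnorm_meas rhoS povm x ji ii).
rewrite -/(correlation rho M x i); set xi := correlation rho M x i.
have hxi := distort k xi (correlation_herm rhoS povm x i)
  (correlation_traceless rhoS povm ji ii pn0).
(* Squaring the trace norms squares the distortion factor, whose exponent is [k / 2]. *)
have -> : (18 * d%:R) ^+ k = ((18 * d%:R) `^ (k%:R / 2)) ^+ 2 :> R.
  by rewrite -[RHS]powR_mulrn ?powR_ge0 // -powRrM divfK ?pnatr_eq0 // powR_mulrn.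
by rewrite -exprMn ler_sqr ?nnegrE ?mulr_ge0 ?powR_ge0 ?trnorm_ge0.
Qed.
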